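(* Let $n\ge1$. For all compositions $\alpha,\beta\in\mathcal{C}_n=(\mathbb{Z}_{\ge0})^n$ we have, in the field $\mathbb{K}=\mathbb{Q}(q,t,a)$, $$\frac{G_\alpha(a\widetilde{\beta})}{G_\alpha(a\tau)}=\frac{G_\beta(a\widetilde{\alpha})}{G_\beta(a\tau)},$$ where $G_\alpha$ are the non-symmetric interpolation Macdonald polynomials.
   Context: Let $q,t,a$ be indeterminates, $\mathbb{F}=\mathbb{Q}(q,t)$, $\mathbb{K}=\mathbb{Q}(q,t,a)$, $x=(x_1,\dots,x_n)$. For $v\in\mathbb{Z}^n$ put $|v|=v_1+\cdots+v_n$ and define $\overline{v}\in\mathbb{F}^n$ by $\overline{v}_i:=q^{v_i}t^{-k_i(v)}$ with $k_i(v):=\#\{k<i\mid v_k\ge v_i\}+\#\{k>i\mid v_k>v_i\}$. Put $\widetilde{v}:=\overline{-w_0v}$, where $w_0v=(v_n,\dots,v_1)$. Put $\tau=(1,t^{-1},\dots,t^{1-n})$, i.e. $\tau_i=t^{1-i}$. For $\alpha\in\mathcal{C}_n$, $G_\alpha(x)=G_\alpha(x;q,t)\in\mathbb{F}[x_1,\dots,x_n]$ is the unique polynomial of degree at most $|\alpha|$ such that $G_\alpha(\overline{\beta})=0$ for all $\beta\in\mathcal{C}_n$ with $|\beta|\le|\alpha|$, $\beta\ne\alpha$, and such that the coefficient of $x^\alpha=x_1^{\alpha_1}\cdots x_n^{\alpha_n}$ in $G_\alpha$ is $1$ (existence and uniqueness are known, as is $G_\alpha(a\tau)\neq0$). *)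

(* Defs.v *)
From HB Require Import structures.
From mathcomp Require Import all_boot all_order all_algebra.
From mathcomp Require Export fraction.
From mathcomp Require Export mpoly.

Set Implicit Arguments.
Unset Strict Implicit.
Unset Printing Implicit Defensive.

Import Order.TTheory GRing.Theory Num.Theory.
Local Open Scope ring_scope.

(* F = Q(q,t). *)
Definition F : fieldType := {fraction {mpoly rat[2]}}.

Definition q : F := tofrac ('X_0 : {mpoly rat[2]}).
Definition t : F := tofrac ('X_1 : {mpoly rat[2]}).

(* K = Q(q,t,a), realized as the field of rational functions F(a). *)
Definition K : fieldType := {fraction {poly F}}.

Definition a : K := tofrac ('X : {poly F}).

Definition iota_FK : F -> K := fun c => tofrac c%:P.

(* k_i(v); positions are numbered from 0, which does not affect it. *)
Definition kstat (n : nat) (v : 'I_n -> int) (i : 'I_n) : nat :=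
  addn #|[set k : 'I_n | (k < i)%N & v i <= v k]|
       #|[set k : 'I_n | (i < k)%N & v i < v k]|.

Definition overline (n : nat) (v : 'I_n -> int) : 'I_n -> F :=
  fun i => q ^ v i * t ^- kstat v i.

Definition w0 (n : nat) (v : 'I_n -> int) : 'I_n -> int :=
  fun i => v (rev_ord i).

Definition tilde (n : nat) (v : 'I_n -> int) : 'I_n -> F :=
  overline (fun i => - w0 v i).

(* With 0-based positions, tau_i = t^(1-i) becomes t^(-i). *)
Definition tau (n : nat) : 'I_n -> F := fun i => t ^- i.

(* A composition is a multinomial 'X_{1..n}, i.e. an exponent vector in N^n,
   and |alpha| is mdeg alpha. *)
Definition zvec (n : nat) (alpha : 'X_{1..n}) : 'I_n -> int :=
  fun i => (alpha i)%:Z.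

(* The defining property of G_alpha; msize is 1 + the total degree
   (0 for the zero polynomial). *)
Definition is_interpolation_macdonald (n : nat) (alpha : 'X_{1..n})
    (G : {mpoly F[n]}) : Prop :=
  [/\ (msize G <= (mdeg alpha).+1)%N,
      forall beta : 'X_{1..n}, (mdeg beta <= mdeg alpha)%N -> beta != alpha ->
        G.@[overline (zvec beta)] = 0
    & G@_alpha = 1].

(* G(a v), an element of K, for v in F^n. *)
Definition eval_scaled (n : nat) (G : {mpoly F[n]}) (v : 'I_n -> F) : K :=
  (map_mpoly iota_FK G).@[fun i => a * iota_FK (v i)].

(* Main.v *)
From HB Require Import structures.
Require Import Defs.
From mathcomp Require Import all_boot all_order all_fingroup all_algebra zify ring.

(* Normalize G_alpha by its value at a tau, and let M(alpha, beta) be its value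
   at a tilde(beta). The Hecke operators H_i map G_alpha to combinations of
   G_alpha and G_(s_i alpha), and act on the values at the points a tilde(beta)
   by the same formula with s_i replaced by s_(n-i); so does the operator
   (x_n - t^(1-n)) f(x_n / q, x_1, ..., x_(n-1)), which sends G_alpha to a
   multiple of G_(alpha_2, ..., alpha_n, alpha_1 + 1). Hence M and its transpose
   satisfy the same recursion, and induction on alpha gives M = M^T. The scalar
   in the second recursion is determined by the eigenvalue of the first
   Cherednik operator, evaluated at a tau. *)

Set Implicit Arguments.
Unset Strict Implicit.
Unset Printing Implicit Defensive.

Import Order.TTheory GRing.Theory Num.Theory.
Local Open Scope ring_scope.

(** * Polynomial functions of bounded degree *)

Section PolynomialFunctions.
Variables (K : fieldType) (n : nat).
Local Notation point := ('I_n -> K).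

(* As for [msize], the bound d is one more than the degree. *)
Definition polyfun (d : nat) (f : point -> K) : Prop :=
  exists2 p : {mpoly K[n]}, (msize p <= d)%N & forall x, f x = p.@[x].

Lemma polyfun_ext d f x y : polyfun d f -> x =1 y -> f x = f y.
Proof. by case=> p _ fE eq_xy; rewrite !fE; apply: meval_eq. Qed.

Lemma polyfun_eq d f g : f =1 g -> polyfun d f -> polyfun d g.
Proof. by move=> fg [p dp fE]; exists p => // x; rewrite -fg. Qed.

Lemma polyfun_leq d d' f : (d <= d')%N -> polyfun d f -> polyfun d' f.
Proof. by move=> le_d [p dp fE]; exists p => //; apply: leq_trans le_d. Qed.

Lemma polyfun0 d : polyfun d (fun=> 0).
Proof. by exists 0 => [|x]; rewrite ?msize0 ?meval0. Qed.

Lemma polyfunC d c : polyfun d.+1 (fun=> c).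
Proof.
exists c%:MP => [|x]; last by rewrite mevalC.
by rewrite msizeC; case: (c != 0).
Qed.

Lemma polyfun_coord d i : polyfun d.+2 (fun x => x i).
Proof. by exists 'X_i => [|x]; rewrite ?msizeX ?mdeg1 ?mevalXU. Qed.

Lemma polyfunD d f g :
  polyfun d f -> polyfun d g -> polyfun d (fun x => f x + g x).
Proof.
move=> [p dp fE] [r dr gE]; exists (p + r) => [|x].
  by apply: leq_trans (msizeD_le _ _) _; rewrite geq_max dp dr.
by rewrite mevalD fE gE.
Qed.

Lemma polyfunZ d c f : polyfun d f -> polyfun d (fun x => c * f x).
Proof.
move=> [p dp fE]; exists (c *: p) => [|x]; last by rewrite mevalZ fE.
exact: leq_trans (msizeZ_le _ _) dp.
Qed.

Lemma polyfunN d f : polyfun d f -> polyfun d (fun x => - f x).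
Proof.
by move=> df; apply: polyfun_eq (polyfunZ (-1) df) => x; rewrite mulN1r.
Qed.

Lemma polyfunB d f g :
  polyfun d f -> polyfun d g -> polyfun d (fun x => f x - g x).
Proof. by move=> df dg; apply: polyfunD df (polyfunN dg). Qed.

Lemma polyfun_sum d (I : Type) (r : seq I) (P : pred I) (F : I -> point -> K) :
  (forall i, P i -> polyfun d (F i)) -> polyfun d (fun x => \sum_(i <- r | P i) F i x).
Proof.
move=> dF; elim: r => [|i r IHr].
  by apply: polyfun_eq (polyfun0 d) => x; rewrite big_nil.
have [Pi|/negPf Pi] := boolP (P i).
  by apply: polyfun_eq (polyfunD (dF i Pi) IHr) => x; rewrite big_cons Pi.
by apply: polyfun_eq IHr => x; rewrite big_cons Pi.
Qed.

Lemma polyfunM_linear d l f :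
  polyfun 2 l -> polyfun d f -> polyfun d.+1 (fun x => l x * f x).
Proof.
move=> [p dp lE] [r dr fE]; exists (p * r) => [|x]; last by rewrite mevalM lE fE.
have [->|p0] := eqVneq p 0; first by rewrite mul0r msize0.
have [->|r0] := eqVneq r 0; first by rewrite mulr0 msize0.
by rewrite msizeM //; move: (msize p) (msize r) dp dr => u v; lia.
Qed.

(** Every monomial arises from 1 by multiplying by one coordinate at a time, so a degree-aware
    property only has to be closed under these operations. *)
Lemma polyfun_ind (Q : nat -> (point -> K) -> Prop) :
    (forall d f g, f =1 g -> Q d f -> Q d g) ->
    (forall d d' f, (d <= d')%N -> Q d f -> Q d' f) ->
    (forall d, Q d (fun=> 0)) ->
    (forall d f g, Q d f -> Q d g -> Q d (fun x => f x + g x)) ->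
    (forall d c f, Q d f -> Q d (fun x => c * f x)) ->
    Q 1 (fun=> 1) ->
    (forall d f i, Q d.+1 f -> Q d.+2 (fun x => x i * f x)) ->
  forall d f, polyfun d f -> Q d f.
Proof.
move=> Qeq Qle Q0 QD QZ Q1 QX d f [p dp fE].
apply: (Qeq d (fun x => p.@[x])) => [x|]; first by rewrite fE.
have QXm (m : 'X_{1..n}) : Q (mdeg m).+1 (fun x => 'X_[m].@[x]).
  have [k] := ubnP (mdeg m); elim: k m => // k IHk m lt_mk.
  have [->|m_neq0] := eqVneq m 0%MM.
    by rewrite mdeg0; apply: Qeq Q1 => x; rewrite mpolyX0 meval1.
  have [i mi] : exists i, m i != 0%N.
    apply/existsP; rewrite -negb_forall; apply: contra m_neq0 => /forallP mi.
    by apply/eqP/mnmP => i; rewrite mnm0E; apply/eqP/mi.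
  have mE : m = (U_(i) + (m - U_(i)))%MM.
    apply/mnmP => j; rewrite mnmDE mnmBE mnm1E.
    by case: eqVneq => [<-|_] /=; move: mi; lia.
  rewrite mE mdegD mdeg1 add1n.
  apply: (Qeq _ (fun x => x i * 'X_[(m - U_(i))%MM].@[x])).
    by move=> x; rewrite mpolyXD mevalM mevalXU.
  by apply/QX/IHk; move: lt_mk; rewrite {1}mE mdegD mdeg1; lia.
rewrite [p in X in Q _ X]mpolyE; rewrite big_seq.
elim/big_ind: _ => [|u v Qu Qv|m m_p].
- by apply: Qeq (Q0 d) => x; rewrite meval0.
- by apply: (Qeq _ (fun x => u.@[x] + v.@[x])) (QD _ _ _ Qu Qv) => x; rewrite mevalD.
- apply: (Qeq _ (fun x => p@_m * 'X_[m].@[x])) => [x|]; first by rewrite mevalZ.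
  by apply: QZ; apply: Qle (QXm m); apply: leq_trans dp; apply: msize_mdeg_lt.
Qed.

Lemma polyfun_subst d f (y : point -> point) :
    (forall i, polyfun 2 (fun x => y x i)) ->
  polyfun d f -> polyfun d (fun x => f (y x)).
Proof.
move=> dy; apply: (@polyfun_ind (fun d f => polyfun d (fun x => f (y x)))).
- by move=> e f1 f2 eq_f; apply: polyfun_eq => x.
- by move=> e e' f1; apply: polyfun_leq.
- exact: polyfun0.
- by move=> e f1 f2; apply: polyfunD.
- by move=> e c f1; apply: polyfunZ.
- exact: polyfunC.
- by move=> e f1 i; apply: polyfunM_linear.
Qed.

(** One statement covers two divisions: [l = x_i - x_j] with [c = e_i - e_j] gives the divided
    difference, and [l = x_0] with [c = e_0] gives division by [x_0] of a function vanishing on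
    [x_0 = 0]. *)
Lemma polyfun_div d f (l : point -> K) (c : 'I_n -> K) :
    polyfun 2 l -> polyfun d f ->
  exists2 g, polyfun d.-1 g &
    forall x, f x - f (fun k => x k - c k * l x) = l x * g x.
Proof.
move=> dl df.
(* The degree bound on f is carried along because the quotient for [x_i * f] involves f itself. *)
suff [] : polyfun d f /\ exists2 g, polyfun d.-1 g &
    forall x, f x - f (fun k => x k - c k * l x) = l x * g x by [].
move: d f df; apply: polyfun_ind.
- move=> e f1 f2 eq_f [df1 [g dg gE]]; split; first exact: polyfun_eq df1.
  by exists g => // x; rewrite -!eq_f.
- move=> e e' f1 le_e [df1 [g dg gE]]; split; first exact: polyfun_leq df1.
  by exists g => //; apply: polyfun_leq dg; lia.
- move=> e; split; first exact: polyfun0.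
  by exists (fun=> 0) => [|x]; [exact: polyfun0 | ring].
- move=> e f1 f2 [df1 [g1 dg1 g1E]] [df2 [g2 dg2 g2E]]; split; first exact: polyfunD.
  exists (fun x => g1 x + g2 x) => [|x]; first exact: polyfunD.
  by rewrite mulrDr -g1E -g2E; ring.
- move=> e b f1 [df1 [g1 dg1 g1E]]; split; first exact: polyfunZ.
  exists (fun x => b * g1 x) => [|x]; first exact: polyfunZ.
  by rewrite mulrCA -g1E mulrBr.
- split; first exact: polyfunC.
  by exists (fun=> 0) => [|x]; [exact: polyfun0 | ring].
- move=> e f1 i [df1 [g1 /= dg1 g1E]].
  split; first exact: (polyfunM_linear (polyfun_coord 0 i) df1).
  (* Product rule: the second term is [c i] times [f1] at the displaced point, rewritten through
     [g1] so that its degree is visible. *)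
  exists (fun x => x i * g1 x + c i * (f1 x - l x * g1 x)) => [/=|x].
    apply: polyfunD; first exact: (polyfunM_linear (polyfun_coord 0 i) dg1).
    by apply/polyfunZ/polyfunB => //; apply: polyfunM_linear.
  by move: (g1E x) => /(canRL (subrK _)) ->; ring.
Qed.

End PolynomialFunctions.

(** * The statistic k_i under swaps, cyclic shift and negation *)

Section Statistic.
Variable n : nat.
Implicit Types (v w : 'I_n -> int) (i j k : 'I_n).

(** [kstat v i] is the rank of i when positions are sorted by decreasing value, with ties broken
    from the left. As a single sum it can be compared term by term. *)
Lemma kstatE v i :
  kstat v i = (\sum_(k < n)
    (((k < i)%N && (v i <= v k)%R) + ((i < k)%N && (v i < v k)%R)))%N.
Proof.
rewrite /kstat big_split /= -!sum1dep_card.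
by congr (_ + _)%N; rewrite big_mkcond; apply: eq_bigr => k _; case: (_ && _).
Qed.

Lemma eq_kstat v w : v =1 w -> kstat v =1 kstat w.
Proof. by move=> eq_vw i; rewrite !kstatE; apply: eq_bigr => k _; rewrite !eq_vw. Qed.

Definition swap_int v i j : 'I_n -> int := fun k => v (tperm i j k).

Definition shift_int v : 'I_n -> int :=
  fun k => v (ordS k) + (k.+1 == n :> nat)%:R.

Definition opp_int v : 'I_n -> int := fun i => - w0 v i.

(** An adjacent swap preserves the relative order of every other pair of positions, and between i
    and j distinct values leave no tie to break. *)
Lemma kstat_swap v i j k : j = i.+1 :> nat -> v i != v j ->
  kstat (swap_int v i j) k = kstat v (tperm i j k).
Proof.
move=> ij vij; rewrite !kstatE (reindex_inj (@perm_inj _ (tperm i j))).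
apply: eq_bigr => l _; rewrite /swap_int tpermK.
case: (tpermP i j l) => [->|->|/eqP + /eqP +];
  case: (tpermP i j k) => [->|->|/eqP + /eqP +];
  rewrite -?val_eqE /=; lia.
Qed.

Lemma kstat_adj v i j : j = i.+1 :> nat -> v i = v j ->
  kstat v j = (kstat v i).+1.
Proof.
move=> ij vij; rewrite !kstatE (bigD1 i) //= [in RHS](bigD1 i) //=.
rewrite -addSn; congr (_ + _)%N; first lia.
apply: eq_bigr => k; have [->|] := eqVneq k j.
  by rewrite vij ltxx !andbF ltnn ij; lia.
by rewrite -!val_eqE vij /= ij; lia.
Qed.

(** The first entry won its ties by position. After moving to the end it wins them by value, since
    for integers [x <= y] is the same as [x < y + 1]. *)
Lemma kstat_shift v k : kstat (shift_int v) k = kstat v (ordS k).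
Proof.
rewrite !kstatE [in RHS](reindex_inj (@ordS_inj n)).
apply: eq_bigr => l _; rewrite /shift_int /=.
have := ltn_ord l; have := ltn_ord k.
have [kn|] := eqVneq k.+1 n; have [ln|] := eqVneq l.+1 n.
- have -> : k = l by apply/val_inj; rewrite /=; lia.
  by rewrite ltnn; lia.
- move=> ? ? ?; rewrite kn modnn modn_small; lia.
- by move=> ? ? ?; rewrite ln modnn modn_small; lia.
- by move=> ? ? ? ?; rewrite !modn_small; lia.
Qed.

(** Negation reverses the order of the values and [w0] reverses the tie-breaking, so each position
    other than i precedes it in exactly one of the two rankings. *)
Lemma kstat_opp v i : (kstat (opp_int v) (rev_ord i) + kstat v i).+1 = n.
Proof.
rewrite !kstatE [in X in (X + _)%N](reindex_inj rev_ord_inj) -big_split /=.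
rewrite (bigD1 i) //= (eq_bigr (fun=> 1%N)); last first.
  move=> k; rewrite -val_eqE /opp_int /w0 !rev_ordK /= => ki.
  by have := ltn_ord i; have := ltn_ord k; lia.
by rewrite sum1_card cardC1 card_ord !ltnn; have := ltn_ord i; lia.
Qed.

Lemma kstat0 v i : v =1 (fun=> 0) -> kstat v i = i.
Proof.
move=> v0; rewrite (eq_kstat v0) /kstat.
rewrite (_ : [set k : 'I_n | _ & 0 < 0] = set0); last first.
  by apply/setP => k; rewrite !inE ltxx andbF.
rewrite cards0 addn0 -sum1dep_card (eq_bigl (fun k : 'I_n => (k < i)%N)); last first.
  by move=> k; rewrite lexx andbT.
by rewrite (big_ord_narrow (ltnW (ltn_ord i))) sum1_card card_ord.
Qed.

End Statistic.

(** * Swaps and shifts of compositions, and induction along them *)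

Section Compositions.
Variable n : nat.
Implicit Types (al be : 'X_{1..n}) (i j k : 'I_n).

Definition swap_comp al i j : 'X_{1..n} := [multinom al (tperm i j k) | k < n].

Definition shift_comp al : 'X_{1..n} :=
  [multinom (al (ordS k) + (k.+1 == n :> nat))%N | k < n].

Definition unshift_comp al : 'X_{1..n} :=
  [multinom (al (ord_pred k) - (k == 0%N :> nat))%N | k < n].

Lemma mdeg_swap al i j : mdeg (swap_comp al i j) = mdeg al.
Proof.
rewrite !mdegE [RHS](reindex_inj (@perm_inj _ (tperm i j))).
by apply: eq_bigr => k _; rewrite mnmE.
Qed.

Lemma swap_compK al i j : swap_comp (swap_comp al i j) i j = al.
Proof. by apply/mnmP => k; rewrite !mnmE tpermK. Qed.

Lemma zvec_swap al i j : zvec (swap_comp al i j) =1 swap_int (zvec al) i j.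
Proof. by move=> k; rewrite /zvec mnmE. Qed.

Lemma zvec_shift al : zvec (shift_comp al) =1 shift_int (zvec al).
Proof. by move=> k; rewrite /zvec /shift_int mnmE; case: eqP => _; lia. Qed.

(** Passing to [-w0] turns the shift into its inverse. This is why the dual recursion leads from
    beta to its shift while alpha is unshifted. *)
Lemma shift_opp al : shift_int (opp_int (zvec (shift_comp al))) =1 opp_int (zvec al).
Proof.
move=> k; rewrite /shift_int /opp_int /w0 /zvec mnmE /=.
have -> : ordS (rev_ord (ordS k)) = rev_ord k.
  apply/val_inj => /=; have ltk := ltn_ord k; have n0 : (0 < n)%N by lia.
  have [->|kn] := eqVneq k.+1 n; first by rewrite modnn subn1 prednK ?modnn ?subnn.
  by rewrite (modn_small (m := k.+1)) ?modn_small; lia.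
have ltk := ltn_ord k; have n0 : (0 < n)%N by lia.
have [->|kn] := eqVneq k.+1 n; first by rewrite modnn subn1 prednK ?eqxx //; lia.
by rewrite (modn_small (m := k.+1)); lia.
Qed.

Lemma swap_opp al i j :
  opp_int (zvec (swap_comp al (rev_ord j) (rev_ord i))) =1
  swap_int (opp_int (zvec al)) i j.
Proof.
move=> k; rewrite /opp_int /swap_int /w0 /zvec mnmE; congr (- (Posz (al _))).
by rewrite tpermC -(inj_tperm _ _ _ rev_ord_inj).
Qed.

Lemma mdeg_shift al : (0 < n)%N -> mdeg (shift_comp al) = (mdeg al).+1.
Proof.
move=> n0; rewrite !mdegE (eq_bigr _ (fun k _ => mnmE _ k)) big_split /=.
rewrite -(reindex_inj (@ordS_inj n) (P := xpredT) (F := fun k => al k)) -addn1.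
congr (_ + _)%N; have nn : (n.-1 < n)%N by lia.
rewrite (bigD1 (Ordinal nn)) //= prednK // eqxx big1 // => k.
by rewrite -val_eqE /=; lia.
Qed.

Lemma shift_unshift al i : i.+1 = n :> nat -> (0 < al i)%N ->
  shift_comp (unshift_comp al) = al.
Proof.
move=> iN ali; apply/mnmP => k; rewrite !mnmE ordSK /=; have := ltn_ord k.
have [kn _|kn ltk] := eqVneq k.+1 n; last by rewrite modn_small; lia.
have -> : k = i by apply/val_inj => /=; lia.
by rewrite iN modnn eqxx; lia.
Qed.

(** If the last entry is positive, undo a shift, which lowers the degree. Otherwise exchange the
    last nonzero entry with the zero to its right, which brings it closer to the end. *)
Lemma composition_ind (P : 'X_{1..n} -> Prop) :
    (0 < n)%N ->
    P 0%MM ->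
    (forall al, P al -> P (shift_comp al)) ->
    (forall al i j, j = i.+1 :> nat -> al i != al j -> P al -> P (swap_comp al i j)) ->
  forall al, P al.
Proof.
move=> n0 P0 Pshift Pswap al.
have [d] := ubnP (mdeg al); elim: d al => // d IHd al lt_d.
(* The weights decrease to the right, so moving a nonzero entry right past a zero lowers this sum at
   fixed degree. *)
have [m] := ubnP (\sum_(k < n) (n - k) * al k)%N.
elim: m al lt_d => // m IHm al lt_d lt_m.
have [->//|al_neq0] := eqVneq al 0%MM.
have nn : (n.-1 < n)%N by lia.
have [l0|lpos] := posnP (al (Ordinal nn)); last first.
  have sE := shift_unshift (i := Ordinal nn) (prednK n0) lpos.
  rewrite -sE; apply/Pshift/IHd; move: lt_d; rewrite -{1}sE mdeg_shift //.
have [i ali] : exists i, al i != 0%N.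
  apply/existsP; rewrite -negb_forall; apply: contra al_neq0 => /forallP al0.
  by apply/eqP/mnmP => i; rewrite mnm0E; apply/eqP/al0.
have {i ali} [i ali imax] :
    exists2 i : 'I_n, al i != 0%N & forall k, al k != 0%N -> (k <= i)%N.
  have [k alk kmax] := @arg_maxnP _ i (fun k => al k != 0%N) (fun k => k : nat) ali.
  by exists k.
have lt_in : (i.+1 < n)%N.
  have := ltn_ord i; rewrite leq_eqVlt => /predU1P[iN|//]; move: ali.
  by rewrite (_ : i = Ordinal nn) ?l0 //; apply/val_inj => /=; lia.
pose j := Ordinal lt_in.
have alj : al j = 0%N by apply/eqP; apply: contraT => /imax /=; lia.
rewrite -(swap_compK al i j); apply: Pswap => //.
  by rewrite !mnmE tpermL tpermR alj eq_sym.
apply: IHm; first by rewrite mdeg_swap.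
have ji : j != i by rewrite -val_eqE /=; lia.
rewrite -ltnS; apply: leq_trans lt_m; rewrite ltnS.
rewrite (bigD1 i) //= [X in (_ < X)%N](bigD1 i) //=.
rewrite (bigD1 j) //= [X in (_ < _ + X)%N](bigD1 j) //=.
rewrite !mnmE tpermL tpermR alj muln0 add0n.
rewrite (eq_bigr (fun k : 'I_n => (n - k) * al k)%N); last first.
  by move=> k /andP[ki kj]; rewrite mnmE tpermD // eq_sym.
by rewrite muln0 addnA addn0 ltn_add2r ltn_mul2r; have := ltn_ord i; lia.
Qed.

End Compositions.

(** * Spectral points, and the shift and Hecke operators acting at them *)

Section Interpolation.
Variables (K : fieldType) (n : nat) (q t : K).
Hypotheses (q0 : q != 0) (t0 : t != 0).
Hypothesis qt_generic : forall i j : int, q ^ i * t ^ j = 1 -> i = 0 /\ j = 0.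

Local Notation N := n.+1.
Local Notation point := ('I_N -> K).
Implicit Types (v w : 'I_N -> int) (i j k : 'I_N) (f g h : point -> K) (x : point).
Implicit Types (al be : 'X_{1..N}) (c : K).

Lemma monomial_inj (i j k l : int) : q ^ i * t ^ j = q ^ k * t ^ l -> i = k /\ j = l.
Proof.
move=> eq_m; suff [] : i - k = 0 /\ j - l = 0 by lia.
apply: qt_generic; rewrite !expfzDr // -!invr_expz mulrACA eq_m.
by rewrite mulrACA !mulfV ?mulr1 ?expfz_neq0.
Qed.

(** The scalar c treats the interpolation nodes ([c = 1]) and the points a tilde(beta) ([c = a])
    together. *)
Definition spectral c v : point := fun k => c * (q ^ v k * t ^- kstat v k).

Lemma spectralE c v k : spectral c v k = c * (q ^ v k * t ^ (- (kstat v k)%:Z)).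
Proof. by rewrite /spectral -exprnN. Qed.

Lemma eq_spectral c v w : v =1 w -> spectral c v =1 spectral c w.
Proof. by move=> vw k; rewrite /spectral (eq_kstat vw) vw. Qed.

Lemma spectral_neq0 c v k : c != 0 -> spectral c v k != 0.
Proof. by move=> c0; rewrite /spectral !mulf_neq0 ?invr_neq0 ?expf_neq0 ?expfz_neq0. Qed.

Lemma spectral_neq c v i j (m : int) : c != 0 -> v i != v j ->
  spectral c v i != t ^ m * spectral c v j.
Proof.
move=> c0 vij; apply: contra vij => /eqP; rewrite !spectralE (mulrCA (t ^ m)) => /(mulfI c0).
by rewrite (mulrCA (t ^ m)) -expfzDr // => /monomial_inj [-> _].
Qed.

Lemma spectral_swap c v i j : j = i.+1 :> nat -> v i != v j ->
  spectral c (swap_int v i j) =1 (fun k => spectral c v (tperm i j k)).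
Proof. by move=> ij vij k; rewrite /spectral kstat_swap. Qed.

Lemma spectral_adj c v i j : j = i.+1 :> nat -> v i = v j ->
  spectral c v i = t * spectral c v j.
Proof.
move=> ij vij; rewrite /spectral (kstat_adj ij vij) vij exprS invfM.
by field; rewrite t0 expf_neq0.
Qed.

Definition unshift_point x : point :=
  fun k => x (ord_pred k) * (if k == 0 :> nat then q^-1 else 1).

Lemma unshift_spectral c v : unshift_point (spectral c (shift_int v)) =1 spectral c v.
Proof.
move=> k; rewrite /unshift_point /spectral kstat_shift /shift_int ord_predK /=.
have ltk := ltn_ord k; have [k0|k0] := eqVneq (k : nat) 0%N.
  rewrite k0 add0n modn_small ?prednK // eqxx expfzDr // expr1z.
  by field; rewrite q0 expf_neq0.
rewrite (_ : _ == N = false) ?addr0 ?mulr1 //.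
rewrite (_ : (k + N).-1 = (k.-1 + N)%N); last lia.
by rewrite modnDr modn_small; lia.
Qed.

Definition shift_op f : point -> K :=
  fun x => (x ord_max - t ^- n) * f (unshift_point x).

Definition vanishing al f : Prop :=
  polyfun (mdeg al).+1 f /\
  forall be, (mdeg be <= mdeg al)%N -> be != al -> f (spectral 1 (zvec be)) = 0.

Lemma shift_op_spectral d c v f : polyfun d f ->
  shift_op f (spectral c (shift_int v)) =
    (spectral c (shift_int v) ord_max - t ^- n) * f (spectral c v).
Proof. by move=> df; rewrite /shift_op (polyfun_ext df (unshift_spectral c v)). Qed.

Lemma polyfun_shift d f : polyfun d f -> polyfun d.+1 (shift_op f).
Proof.
move=> df; apply: polyfunM_linear.
  exact: polyfunB (polyfun_coord _ _ _) (polyfunC _ _ _).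
apply: polyfun_subst df => i.
have di := polyfunZ (if i == 0 :> nat then q^-1 else 1) (polyfun_coord K 0 (ord_pred i)).
by apply: polyfun_eq di => x; rewrite mulrC.
Qed.

(** A zero in last place is a smallest entry of a composition and loses every tie, so its rank is
    n. *)
Lemma spectral_last c be : be ord_max = 0%N ->
  spectral c (zvec be) ord_max = c * t ^- n.
Proof.
move=> be0; rewrite /spectral {1}/zvec be0 expr0z mul1r; congr (_ * _ ^- _).
rewrite /kstat [X in (_ + X)%N]eq_card0 ?addn0; last first.
  by move=> k; rewrite !inE ltnNge -ltnS ltn_ord.
rewrite -sum1dep_card (eq_bigl (fun k : 'I_N => (k < n)%N)); last first.
  by move=> k; rewrite /zvec be0 andbT.
by rewrite (big_ord_narrow (leqnSn n)) sum1_card card_ord.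
Qed.


(** The linear factor kills the nodes whose last entry is zero. Every other node is a shifted one,
    where [shift_op f] is a multiple of f at the unshifted node. *)
Lemma vanishing_shift al f : vanishing al f -> vanishing (shift_comp al) (shift_op f).
Proof.
move=> [df f0]; split; first by rewrite mdeg_shift //; apply: polyfun_shift.
rewrite mdeg_shift // => be le_be be_al; have [be0|be_gt0] := posnP (be ord_max).
  by rewrite /shift_op spectral_last // mul1r subrr mul0r.
have sE := shift_unshift (i := ord_max) erefl be_gt0.
move: le_be be_al; rewrite -sE mdeg_shift // ltnS => le_be be_al.
rewrite (polyfun_ext (polyfun_shift df) (eq_spectral 1 (zvec_shift (unshift_comp be)))).
rewrite (shift_op_spectral _ _ df) f0 ?mulr0 //.
by apply: contra be_al => /eqP ->.
Qed.

(** h is the image of f under a Demazure-Lusztig operator, with the denominator cleared. The first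
    identity says nothing where [x i = x j], so the values on [x i = t * x j] and on [x i = 0] are
    recorded separately, including the points with [x j = 0]. *)
Definition is_hecke i j f h : Prop :=
  [/\ forall x, (x i - x j) * h x =
        (t - 1) * x i * f x + (x i - t * x j) * f (fun k => x (tperm i j k)),
      forall x, x i = t * x j -> h x = t * f x
    & forall x, x i = 0 -> h x = t * f (fun k => x (tperm i j k))].

Lemma hecke_exists d i j f : i != j -> polyfun d.+1 f ->
  exists2 h, polyfun d.+1 h & is_hecke i j f h.
Proof.
move=> ij df; have dl : polyfun 2 (fun x : point => x i - x j).
  exact: polyfunB (polyfun_coord _ _ _) (polyfun_coord _ _ _).
(* Subtracting [x_i - x_j] times [e_i - e_j] from x exchanges its coordinates i and j, so g is the
   divided difference of f. *)
have [g /= dg gE] := polyfun_div (fun k => (k == i)%:R - (k == j)%:R) dl df.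
have {}gE x : f x - f (fun k => x (tperm i j k)) = (x i - x j) * g x.
  rewrite -gE; congr (_ - _); apply: (polyfun_ext df) => k.
  case: tpermP => [->|->|/eqP/negPf -> /eqP/negPf ->]; last by rewrite /=; ring.
    by rewrite eqxx (negPf ij) /=; ring.
  by rewrite eqxx eq_sym (negPf ij) /=; ring.
exists (fun x => t * f x - (x i - t * x j) * g x).
  apply: polyfunB; first exact: polyfunZ.
  apply: polyfunM_linear dg.
  by apply: polyfunB (polyfun_coord _ _ _) _; apply/polyfunZ/polyfun_coord.
split=> x.
- by rewrite mulrBr (mulrCA _ (x i - t * x j)) -gE; ring.
- by move=> ->; ring.
- move=> xi0; move: (gE x); rewrite xi0 !sub0r mulNr => /(canRL (subrK _)).
  by move=> ->; ring.
Qed.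

Definition hecke_coef v i j : K :=
  (t - 1) * spectral 1 v i / (spectral 1 v i - spectral 1 v j).

Lemma t_neq1 : t != 1.
Proof. by apply/eqP => t1; case: (@qt_generic 0 1) => //; rewrite t1 expr1z mulr1. Qed.

Lemma hecke_coef_adj v i j : j = i.+1 :> nat -> v i = v j -> hecke_coef v i j = t.
Proof.
move=> ij vij; rewrite /hecke_coef (spectral_adj 1 ij vij).
have := t_neq1; rewrite -subr_eq0 => t1.
have s0 := spectral_neq0 v j (oner_neq0 K).
have {}t1 : t * spectral 1 v j - spectral 1 v j != 0.
  by rewrite -[X in _ - X]mul1r -mulrBl mulf_neq0.
by field.
Qed.

Lemma spectral_scale c v k : spectral c v k = c * spectral 1 v k.
Proof. by rewrite /spectral mul1r. Qed.

(** The coefficients are homogeneous of degree 0, hence independent of c. If [v i = v j], the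
    permuted point is not spectral, but then [x i = t * x j] and the coefficient of the second term
    is zero. *)
Lemma hecke_spectral d c v i j f h : c != 0 -> j = i.+1 :> nat -> polyfun d f ->
    is_hecke i j f h ->
  h (spectral c v) = hecke_coef v i j * f (spectral c v) +
    (t - hecke_coef v i j) * f (spectral c (swap_int v i j)).
Proof.
move=> c0 ij df [hE hadj _]; have [vij|vij] := eqVneq (v i) (v j).
  by rewrite hecke_coef_adj // subrr mul0r addr0 hadj // (spectral_adj _ ij vij).
have := hE (spectral c v).
rewrite -(polyfun_ext df (spectral_swap c ij vij)) !(spectral_scale c v) => hsE.
have s0 : spectral 1 v i - spectral 1 v j != 0.
  by rewrite subr_eq0 -[X in _ != X]mul1r -[X in X * _](expr0z t) spectral_neq ?oner_neq0.
apply: (mulfI c0); apply: (mulfI s0); rewrite mulrA (mulrC _ c) mulrBr hsE.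
by rewrite /hecke_coef; field.
Qed.

Lemma hecke_coef_neq v i j : v i != v j -> t - hecke_coef v i j != 0.
Proof.
move=> vij; have s0 : spectral 1 v i - spectral 1 v j != 0.
  by rewrite subr_eq0 -[X in _ != X]mul1r -[X in X * _](expr0z t) spectral_neq ?oner_neq0.
have -> : t - hecke_coef v i j =
    (spectral 1 v i - t * spectral 1 v j) / (spectral 1 v i - spectral 1 v j).
  by rewrite /hecke_coef; field.
by rewrite mulf_neq0 ?invr_neq0 // subr_eq0 -[X in X * _]expr1z spectral_neq ?oner_neq0.
Qed.

(** g is H_i f minus the multiple of f that cancels its value at the node of [al]. Among the nodes
    of degree at most that of [al], only the swapped one can then carry a nonzero value. *)
Lemma vanishing_swap al i j f : j = i.+1 :> nat -> al i != al j ->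
    vanishing al f ->
  exists2 g, vanishing (swap_comp al i j) g &
    forall c v, c != 0 -> g (spectral c v) =
      (hecke_coef v i j - hecke_coef (zvec al) i j) * f (spectral c v) +
      (t - hecke_coef v i j) * f (spectral c (swap_int v i j)).
Proof.
move=> ij alij [df f0]; have ji : i != j by rewrite -val_eqE /=; lia.
have [h dh hH] := hecke_exists ji df.
pose g x := h x - hecke_coef (zvec al) i j * f x.
have gE c v : c != 0 -> g (spectral c v) =
      (hecke_coef v i j - hecke_coef (zvec al) i j) * f (spectral c v) +
      (t - hecke_coef v i j) * f (spectral c (swap_int v i j)).
  by move=> c0; rewrite /g (hecke_spectral v c0 ij df hH); ring.
exists g => //; split; rewrite mdeg_swap.
  exact: polyfunB dh (polyfunZ _ df).
move=> be le_be be_al; rewrite gE ?oner_neq0 //.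
have neq_al : swap_comp be i j != al.
  by apply: contra be_al => /eqP <-; rewrite swap_compK.
rewrite -(polyfun_ext df (eq_spectral 1 (zvec_swap be i j))).
rewrite (f0 (swap_comp _ _ _)) ?mdeg_swap //.
have [->|beal] := eqVneq be al; first by rewrite subrr mul0r mulr0 addr0.
by rewrite f0 // !mulr0 addr0.
Qed.

(** * Existence and uniqueness of interpolation at the spectral points *)

Lemma vanishing_exists al :
  exists2 f, vanishing al f & f (spectral 1 (zvec al)) != 0.
Proof.
elim/composition_ind: al => // [|al [f vf fal]|al i j ij alij [f vf fal]].
- exists (fun=> 1) => [|/=]; last exact: oner_neq0.
  split; first exact: polyfunC.
  by move=> be; rewrite mdeg0 leqn0 mdeg_eq0 => ->.
- exists (shift_op f); first exact: vanishing_shift.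
  have [df _] := vf.
  rewrite (polyfun_ext (polyfun_shift df) (eq_spectral 1 (zvec_shift al))).
  rewrite (shift_op_spectral _ _ df) mulf_neq0 // subr_eq0 spectralE mul1r.
  (* The shift makes the last entry positive, so that coordinate has a positive power of q and
     differs from [t ^- n]. *)
  apply/eqP; rewrite exprnN -[X in _ = X]mul1r -(expr0z q) => /monomial_inj [].
  by rewrite /shift_int eqxx /zvec; lia.
- have [g vg gE] := vanishing_swap ij alij vf; exists g => //.
  have [df f0] := vf.
  rewrite gE ?oner_neq0 // f0 ?mdeg_swap //; last first.
    apply: contra alij => /eqP/mnmP/(_ i); rewrite mnmE tpermL => ->; exact: eqxx.
  rewrite mulr0 add0r mulf_neq0 //.
    by apply: hecke_coef_neq; rewrite /zvec !mnmE tpermL tpermR; move: alij; lia.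
  rewrite -(polyfun_ext df (eq_spectral 1 (zvec_swap _ i j))).
  by rewrite swap_compK.
Qed.

(** Newton interpolation by degree: the functions correcting the values in degree d vanish at all
    nodes of smaller degree and at the other nodes of degree d, so earlier values survive. *)
Lemma interpolation_exists d (F : 'X_{1..N} -> K) :
  exists2 f, polyfun d f & forall be, (mdeg be < d)%N -> f (spectral 1 (zvec be)) = F be.
Proof.
elim: d => [|d [f df fE]]; first by exists (fun=> 0) => //; apply: polyfun0.
have [E vE nzE] := fin_all_exists2 (fun al : 'X_{1..N < d.+1} => vanishing_exists al).
pose g x := f x + \sum_(al : 'X_{1..N < d.+1} | mdeg al == d)
  (F al - f (spectral 1 (zvec al))) / E al (spectral 1 (zvec al)) * E al x.
exists g => [|be].
  apply: polyfunD; first by apply: polyfun_leq df.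
  apply: polyfun_sum => al /eqP al_d.
  by have [dE _] := vE al; rewrite al_d in dE; apply: polyfunZ.
rewrite ltnS leq_eqVlt => /predU1P[be_d|lt_be]; last first.
  rewrite /g fE // big1 ?addr0 // => al /eqP al_d.
  have [_ E0] := vE al; rewrite (E0 be) ?mulr0 ?al_d ?(ltnW lt_be) //.
  by apply: contraTneq lt_be => ->; rewrite al_d ltnn.
have lt_be : (mdeg be < d.+1)%N by rewrite be_d.
rewrite /g (bigD1 (BMultinom lt_be)) /= ?be_d //.
have Ebe := nzE (BMultinom lt_be).
rewrite big1 => [|al /andP[/eqP al_d]]; first by rewrite addr0 divfK // addrC subrK.
rewrite bmeqP /= => al_be; have [_ E0] := vE al.
by rewrite (E0 be) ?mulr0 // ?be_d ?al_d // eq_sym.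
Qed.

(* The evaluation matrix of the monomials of degree < d at the spectral points
   of size < d is square, and interpolation provides a one-sided inverse. *)
Lemma mpoly_unisolvence d (p : {mpoly K[N]}) : (msize p <= d)%N ->
    (forall be, (mdeg be < d)%N -> p.@[spectral 1 (zvec be)] = 0) ->
  p = 0.
Proof.
move=> dp p0; set B : finType := 'X_{1..N < d}.
pose J : finType := 'I_#|B|; pose e (i : J) : B := enum_val i.
pose V := \matrix_(i, j < #|B|) ('X_[e i] : {mpoly K[N]}).@[spectral 1 (zvec (e j))].
have evalV (r : {mpoly K[N]}) : (msize r <= d)%N -> forall j : J,
    r.@[spectral 1 (zvec (e j))] = ((\row_(i < #|B|) r@_(e i)) *m V) 0 j.
  move=> dr j; rewrite {1}(mpolywE dr) raddf_sum /= mxE.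
  rewrite (eq_bigl (fun m => m \in B)) // big_enum_val.
  by apply: eq_bigr => i _; rewrite !mxE mevalZ.
have /fin_all_exists2[L dL LE] (i : J) : exists2 r : {mpoly K[N]}, (msize r <= d)%N &
    forall j : J, r.@[spectral 1 (zvec (e j))] = (i == j)%:R.
  have [g [r dr gE] gF] := interpolation_exists d (fun be => (be == e i :> 'X_{1..N})%:R).
  exists r => // j; rewrite -gE gF ?bmdeg //.
  by rewrite -bmeqP (inj_eq enum_val_inj) eq_sym.
pose C := \matrix_(i, j < #|B|) (L i)@_(e j).
have CV : C *m V = 1%:M.
  apply/matrixP => i j; rewrite [RHS]mxE; apply: etrans (LE i j).
  by rewrite evalV // !mxE; apply: eq_bigr => k _; rewrite !mxE.
have coef0 : \row_(i < #|B|) p@_(e i) = 0.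
  rewrite -[LHS]mulmx1 -(mulmx1C CV) mulmxA [X in X *m _](_ : _ = 0) ?mul0mx //.
  by apply/rowP => j; rewrite -evalV // p0 ?bmdeg // mxE.
rewrite (mpolywE dp) big1 // => m _.
by have /rowP/(_ (enum_rank m)) := coef0; rewrite !mxE /e enum_rankK => ->;
  rewrite scale0r.
Qed.

Lemma unisolvence d f : polyfun d f ->
    (forall be, (mdeg be < d)%N -> f (spectral 1 (zvec be)) = 0) ->
  forall x, f x = 0.
Proof.
move=> [p dp fE] f0 x; rewrite fE (mpoly_unisolvence dp) ?meval0 // => be be_d.
by rewrite -fE f0.
Qed.

Lemma vanishing_eq al f g : vanishing al f -> vanishing al g ->
    f (spectral 1 (zvec al)) = g (spectral 1 (zvec al)) -> f =1 g.
Proof.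
move=> [df f0] [dg g0] eq_al x; apply/eqP; rewrite -subr_eq0; apply/eqP; move: x.
apply: (unisolvence (polyfunB df dg)) => be; rewrite ltnS => le_be.
have [->|be_al] := eqVneq be al; first by rewrite eq_al subrr.
by rewrite f0 // g0 // subrr.
Qed.

Lemma vanishingZ al c f : vanishing al f -> vanishing al (fun x => c * f x).
Proof.
move=> [df f0]; split; first exact: polyfunZ.
by move=> be le_be be_al; rewrite f0 ?mulr0.
Qed.

Lemma vanishing_scale al f g : vanishing al f -> vanishing al g ->
  f (spectral 1 (zvec al)) != 0 -> exists c, forall x, g x = c * f x.
Proof.
move=> vf vg f0; exists (g (spectral 1 (zvec al)) / f (spectral 1 (zvec al))).
by apply: (vanishing_eq vg (vanishingZ _ vf)); rewrite divfK.
Qed.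

(** * Evaluation at the dual points a tilde(beta) *)

Variable a : K.
Hypothesis a0 : a != 0.
Hypothesis a_generic : forall i j : int, a * (q ^ i * t ^ j) != 1.

Definition dual_point be : point := spectral a (opp_int (zvec be)).

(** Multiplied by [t ^- n], this is the linear factor of [shift_op] at [dual_point be]. The inverse
    of the spectral coordinate is also the eigenvalue of the first Cherednik operator. *)
Definition dual_eigenvalue be : K := a / spectral 1 (zvec be) ord0 - 1.

Lemma dual_eigenvalue_neq0 be : dual_eigenvalue be != 0.
Proof.
rewrite /dual_eigenvalue subr_eq0 spectralE mul1r invfM !invr_expz.
exact: a_generic.
Qed.

(** Since the ranks are complementary, duality inverts every coordinate up to one common factor. *)
Lemma spectral_opp c v k :
  spectral c (opp_int v) (rev_ord k) = c / spectral 1 v k * t ^- n.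
Proof.
rewrite !spectralE mul1r exprnN invfM !invr_expz opprK -!mulrA -expfzDr //.
rewrite /opp_int /w0 rev_ordK; congr (_ * (_ * t ^ _)).
by have := kstat_opp v k; rewrite /opp_int /w0; lia.
Qed.

(** Inverting both coordinates exchanges their roles in the ratio. Thus the Hecke recursion in beta
    has the same coefficients as the one in alpha, with indices reversed. *)
Lemma hecke_coef_opp v i j :
  hecke_coef (opp_int v) i j = hecke_coef v (rev_ord j) (rev_ord i).
Proof.
rewrite /hecke_coef -[i in LHS]rev_ordK -[j in LHS]rev_ordK !spectral_opp.
have := spectral_neq0 v (rev_ord i) (oner_neq0 K).
have := spectral_neq0 v (rev_ord j) (oner_neq0 K).
move: (spectral 1 v (rev_ord j)) (spectral 1 v (rev_ord i)) => x y x0 y0.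
have : t ^- n != 0 by rewrite invr_neq0 ?expf_neq0.
move: (t ^- n) => T T0.
have -> : 1 / y * T - 1 / x * T = (x - y) * (T / (x * y)) by field; rewrite y0.
by rewrite invfM; move: (x - y)^-1 => z; field; rewrite y0 x0.
Qed.

Lemma shift_op_dual d f be : polyfun d f ->
  shift_op f (dual_point be) =
    t ^- n * dual_eigenvalue be * f (dual_point (shift_comp be)).
Proof.
move=> df; rewrite /dual_point.
rewrite -(polyfun_ext (polyfun_shift df) (eq_spectral a (shift_opp be))).
rewrite (shift_op_spectral _ _ df) (eq_spectral a (shift_opp be)).
have -> : @ord_max n = rev_ord ord0 by apply/val_inj; rewrite /= subn1.
by rewrite spectral_opp /dual_eigenvalue; congr (_ * _); ring.
Qed.

(** Consequently every Hecke operator multiplies the value at a tau by t. *)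
Lemma dual_point0_adj i j : j = i.+1 :> nat ->
  dual_point 0%MM i = t * dual_point 0%MM j.
Proof. by move=> ij; apply: spectral_adj => //; rewrite /opp_int /w0 /zvec !mnm0E. Qed.

Lemma dual_point0 k : dual_point 0%MM k = a * t ^- k.
Proof.
have z0 i : opp_int (zvec (0%MM : 'X_{1..N})) i = 0.
  by rewrite /opp_int /w0 /zvec mnm0E oppr0.
by rewrite /dual_point /spectral kstat0 // z0 expr0z mul1r.
Qed.

(** When [x_k = 0], this moves that zero coordinate to the last place. *)
Definition rotate_from (k : nat) x : point :=
  fun l => if (l < k)%N then x l else if (l < n)%N then x (inord l.+1) else 0.

(** h is the result of applying to f the last k Hecke operators, the rightmost one first. *)
Lemma hecke_chain al f (k : nat) : polyfun (mdeg al).+2 f -> (k <= n)%N ->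
    (forall be, (mdeg be <= mdeg al)%N -> f (spectral 1 (zvec be)) = 0) ->
  exists h, [/\ polyfun (mdeg al).+2 h,
    forall be, (mdeg be <= mdeg al)%N -> h (spectral 1 (zvec be)) = 0,
    h (dual_point 0%MM) = t ^+ k * f (dual_point 0%MM)
  & forall x, x (inord (n - k)) = 0 -> h x = t ^+ k * f (rotate_from (n - k) x)].
Proof.
move=> df + f0; elim: k => [_|k IHk lt_kn].
  exists f; split=> //; first by rewrite expr0 mul1r.
  move=> x; rewrite subn0 => xn0; rewrite expr0 mul1r; apply: (polyfun_ext df) => l.
  rewrite /rotate_from; have := ltn_ord l; rewrite ltnS leq_eqVlt => /predU1P[ln|->//].
  by rewrite ln ltnn -[RHS]xn0; congr x; apply/val_inj; rewrite /= inordK ?ln.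
have [h [dh h0 hdual hrot]] := IHk (ltnW lt_kn).
pose i : 'I_N := inord (n - k.+1); pose j : 'I_N := inord (n - k).
have iE : i = (n - k.+1)%N :> nat by rewrite inordK //; lia.
have jE : j = (n - k)%N :> nat by rewrite inordK //; lia.
have ij : j = i.+1 :> nat by lia.
have ji : i != j by rewrite -val_eqE /=; lia.
have [h' dh' hH] := hecke_exists ji dh; exists h'; split=> //.
- move=> be le_be; rewrite (hecke_spectral _ (oner_neq0 K) ij dh hH) h0 //.
  rewrite -(polyfun_ext dh (eq_spectral 1 (zvec_swap be i j))) h0 ?mdeg_swap //.
  by rewrite !mulr0 addr0.
- by have [_ hadj _] := hH; rewrite (hadj _ (dual_point0_adj ij)) hdual exprS mulrA.
(* On [x i = 0] the operator is t times the swap, which puts the zero at j, where the induction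
   hypothesis takes over. *)
- move=> x xi0; have [_ _ hzero] := hH; rewrite (hzero _ xi0).
  rewrite hrot ?tpermR // exprS mulrA; congr (_ * _); apply: (polyfun_ext df) => l.
  rewrite /rotate_from -jE -iE ij ltnS; have ltl := ltn_ord l.
  have [li|il|/val_inj ->] := ltngtP l i.
  + by rewrite tpermD // -val_eqE /=; lia.
  + case: ifP => // ln; rewrite tpermD // -val_eqE /= inordK; lia.
  + have lt_in : (i < n)%N by lia.
    by rewrite tpermL lt_in -ij inord_val.
Qed.

(* Evaluating at the dual origin the eigenvalue equation of the Cherednik
   operator x_1^-1 (1 + H_1 ... H_(n-1) shift_op); it preserves polynomials
   because, on x_1 = 0, each H_i reduces to t s_i. *)
Lemma dual_shift0 al f : vanishing al f ->
  dual_eigenvalue 0%MM * f (dual_point (shift_comp 0%MM)) =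
  dual_eigenvalue al * f (dual_point 0%MM).
Proof.
move=> vf; have [df f0] := vf; have [dsf sf0] := vanishing_shift vf.
rewrite mdeg_shift // in dsf sf0.
have {}sf0 be : (mdeg be <= mdeg al)%N -> shift_op f (spectral 1 (zvec be)) = 0.
  move=> le_be; apply: sf0; first exact: leqW.
  by apply: contraTneq le_be => ->; rewrite mdeg_shift // ltnn.
have [h [dh h0 hdual hrot]] := hecke_chain dsf (leqnn n) sf0.
rewrite subnn in hrot.
have inord0 : inord 0 = ord0 :> 'I_N by apply/val_inj; rewrite /= inordK.
(* The rotated point has last coordinate 0, so the factor of [shift_op] is [- t ^- n], cancelling
   [t ^+ n] up to sign, and [unshift_point] restores x. *)
have hf0 x : x ord0 = 0 -> h x + f x = 0.
  move=> x0; rewrite hrot ?inord0 // /shift_op {1}/rotate_from ltnn sub0r mulNr mulrN.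
  rewrite mulrA mulfV ?expf_neq0 // mul1r addrC; apply/eqP; rewrite subr_eq0; apply/eqP.
  apply: (polyfun_ext df) => k; rewrite /unshift_point /rotate_from ltn0 /=.
  have ltk := ltn_ord k; have [k0|k0] := eqVneq (k : nat) 0%N.
    rewrite k0 add0n modn_small //= ltnn mul0r.
    by rewrite (_ : k = ord0) //; apply/val_inj.
  rewrite (_ : (k + N).-1 = (k.-1 + N)%N); last lia.
  rewrite modnDr modn_small; last lia.
  have ltk1 : (k.-1 < n)%N by lia.
  by rewrite ltk1 prednK ?lt0n // inord_val mulr1.
have dhf : polyfun (mdeg al).+2 (fun x => h x + f x).
  by apply: polyfunD dh _; apply: polyfun_leq df.
have [g /= dg gE] := polyfun_div (fun k => (k == ord0)%:R) (polyfun_coord K 0 ord0) dhf.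
have {}gE x : h x + f x = x ord0 * g x.
  by rewrite -gE [X in _ - X]hf0 ?subr0 //= mul1r subrr.
have s0 be : spectral 1 (zvec be) ord0 != 0 by rewrite spectral_neq0 ?oner_neq0.
have vg : vanishing al g.
  split=> // be le_be be_al; apply: (mulfI (s0 be)).
  by rewrite -gE h0 // f0 // addr0 mulr0.
(* h vanishes at the node of [al], so g equals f divided by the first coordinate there; uniqueness
   extends this to all points. *)
have gf : g =1 (fun x => (spectral 1 (zvec al) ord0)^-1 * f x).
  apply: (vanishing_eq vg (vanishingZ _ vf)); apply: (mulfI (s0 al)).
  by rewrite -gE h0 // add0r mulVKf.
move: (gE (dual_point 0%MM)); rewrite hdual (shift_op_dual _ df) gf dual_point0.
rewrite invr1 mulr1 !mulrA mulfV ?expf_neq0 // mul1r => /(canRL (addrK _)) ->.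
by rewrite /dual_eigenvalue; ring.
Qed.

Lemma shift_op_dual0 al f : vanishing al f ->
  shift_op f (dual_point 0%MM) = t ^- n * dual_eigenvalue al * f (dual_point 0%MM).
Proof.
move=> vf; have [df _] := vf.
by rewrite (shift_op_dual _ df) -!mulrA (dual_shift0 vf).
Qed.

(** * Normalization at a tau, the two recursions and duality *)

Definition normalized al f : Prop := vanishing al f /\ f (dual_point 0%MM) = 1.

Lemma normalized_nonzero al f : normalized al f -> f (spectral 1 (zvec al)) != 0.
Proof.
move=> [[df f0] f1]; apply/eqP => fal; have /eqP[] := oner_neq0 K; rewrite -f1.
apply: (unisolvence df) => be; rewrite ltnS => le_be.
by have [->//|be_al] := eqVneq be al; rewrite f0.
Qed.

Lemma normalized_scale al f g : normalized al f -> vanishing al g ->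
  forall x, g x = g (dual_point 0%MM) * f x.
Proof.
move=> nf vg x; have [vf f1] := nf.
by have [c gE] := vanishing_scale vf vg (normalized_nonzero nf); rewrite !gE f1 mulr1.
Qed.

Lemma hecke_coef0 i j : j = i.+1 :> nat ->
  hecke_coef (opp_int (zvec (0%MM : 'X_{1..N}))) i j = t.
Proof. by move=> ij; apply: hecke_coef_adj; rewrite // /opp_int /w0 /zvec !mnm0E. Qed.

(** The value at a tau is followed along [composition_ind]: a shift multiplies it by
    [t ^- n * dual_eigenvalue al], a swap by [t - hecke_coef (zvec al) i j], both nonzero. *)
Lemma normalized_exists al : exists f, normalized al f.
Proof.
elim/composition_ind: al => // [|al [f [vf f1]]|al i j ij alij [f [vf f1]]].
- exists (fun=> 1); split=> //; split; first exact: polyfunC.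
  by move=> be; rewrite mdeg0 leqn0 mdeg_eq0 => ->.
- exists (fun x => (t ^- n * dual_eigenvalue al)^-1 * shift_op f x).
  split; first exact/vanishingZ/vanishing_shift.
  rewrite (shift_op_dual0 vf) f1 mulr1 mulVf //.
  by rewrite mulf_neq0 ?invr_neq0 ?expf_neq0 ?dual_eigenvalue_neq0.
- have [g vg gE] := vanishing_swap ij alij vf; have [df _] := vf.
  exists (fun x => (t - hecke_coef (zvec al) i j)^-1 * g x).
  split; first exact: vanishingZ.
  rewrite gE // hecke_coef0 // subrr mul0r addr0 f1 mulr1 mulVf //.
  by apply: hecke_coef_neq; rewrite /zvec; move: alij; lia.
Qed.

(** Up to [t ^- n], both sides are [shift_op f] at [dual_point be]: on the left as a multiple of g
    found at a tau, on the right by direct evaluation. *)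
Lemma normalized_shift al f g be : normalized al f -> normalized (shift_comp al) g ->
  dual_eigenvalue al * g (dual_point be) =
  dual_eigenvalue be * f (dual_point (shift_comp be)).
Proof.
move=> [vf f1] ng; have [df _] := vf.
have := normalized_scale ng (vanishing_shift vf) (dual_point be).
rewrite (shift_op_dual0 vf) f1 mulr1 (shift_op_dual _ df) -!mulrA.
by move/mulfI => ->//; rewrite invr_neq0 ?expf_neq0.
Qed.

(** Both sides are H_i f at [spectral a v]: on the left expanded in f and g, on the right evaluated
    pointwise. If [al i = al j], then H_i f = t f. *)
Lemma normalized_swap al f g v i j : j = i.+1 :> nat ->
    normalized al f -> normalized (swap_comp al i j) g ->
  hecke_coef (zvec al) i j * f (spectral a v) +
    (t - hecke_coef (zvec al) i j) * g (spectral a v) =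
  hecke_coef v i j * f (spectral a v) +
    (t - hecke_coef v i j) * f (spectral a (swap_int v i j)).
Proof.
move=> ij nf ng; have [[df f0] f1] := nf; have [vf _] := nf.
have [alij|alij] := eqVneq (al i) (al j).
  have zij : zvec al i = zvec al j by rewrite /zvec alij.
  rewrite (hecke_coef_adj ij zij) subrr mul0r addr0.
  have ji : i != j by rewrite -val_eqE /=; lia.
  have [h dh hH] := hecke_exists ji df; rewrite -(hecke_spectral v a0 ij df hH).
  suff vh : vanishing al h.
    have [_ hadj _] := hH.
    by rewrite (normalized_scale nf vh) hadj ?f1 ?mulr1 //; apply: dual_point0_adj.
  split=> // be le_be be_al; rewrite (hecke_spectral _ (oner_neq0 K) ij df hH) f0 //.
  rewrite -(polyfun_ext df (eq_spectral 1 (zvec_swap be i j))) f0 ?mdeg_swap //.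
    by rewrite !mulr0 addr0.
  apply: contra be_al => /eqP be_al; rewrite -(swap_compK be i j) be_al.
  apply/eqP/mnmP => k.
  by rewrite mnmE; case: tpermP => [->|->|].
have [h vh hE] := vanishing_swap ij alij vf.
have := normalized_scale ng vh (spectral a v).
rewrite !hE // hecke_coef0 // subrr mul0r addr0 f1 mulr1 => <-.
by ring.
Qed.

Lemma normalized_duality al be f g : normalized al f -> normalized be g ->
  f (dual_point be) = g (dual_point al).
Proof.
elim/composition_ind: al be f g => // [|al IHal|al i j ij alij IHal] be f g nf ng.
- have v1 : vanishing 0%MM (fun=> 1).
    split; first exact: polyfunC.
    by move=> ga; rewrite mdeg0 leqn0 mdeg_eq0 => ->.
  have [_ ->] := ng.
  by have := normalized_scale nf v1 (dual_point be); rewrite mul1r.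
- have [f' nf'] := normalized_exists al.
  have [g' ng'] := normalized_exists (shift_comp be).
  apply: (mulfI (dual_eigenvalue_neq0 al)).
  rewrite (normalized_shift _ nf' nf) (IHal _ _ _ nf' ng').
  by rewrite (normalized_shift _ ng ng').
- have [f' nf'] := normalized_exists al.
  have ji : rev_ord i = (rev_ord j).+1 :> nat by have := ltn_ord j; rewrite /= ij; lia.
  (* At the dual points H_i swaps the reversed positions of [be], so the induction hypothesis is
     used for [be] and for this swap of it. *)
  have [g' ng'] := normalized_exists (swap_comp be (rev_ord j) (rev_ord i)).
  have zij : t - hecke_coef (zvec al) i j != 0.
    by apply: hecke_coef_neq; rewrite /zvec; move: alij; lia.
  apply: (mulfI zij); apply: (addrI (hecke_coef (zvec al) i j * f' (dual_point be))).
  rewrite (normalized_swap _ ij nf' nf) hecke_coef_opp.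
  have [[df' _] _] := nf'; have [[dg _] _] := ng.
  rewrite -(polyfun_ext df' (eq_spectral a (swap_opp be i j))).
  rewrite !(IHal _ _ _ nf' ng) (IHal _ _ _ nf' ng') (normalized_swap _ ji ng ng').
  rewrite hecke_coef_opp !rev_ordK; congr (_ + _ * _); apply: (polyfun_ext dg).
  by move=> k; rewrite -(eq_spectral a (swap_opp al _ _)) !rev_ordK.
Qed.

End Interpolation.

(** * Genericity criteria *)

Lemma monomial_inj_int (L : fieldType) (x y : L) : x != 0 -> y != 0 ->
    (forall i j k l : nat, x ^+ i * y ^+ j = x ^+ k * y ^+ l -> i = k /\ j = l) ->
  forall i j : int, x ^ i * y ^ j = 1 -> i = 0 /\ j = 0.
Proof.
move=> x0 y0 inj_xy i j.
have diff (m : int) : exists k l : nat, m = k%:Z - l%:Z.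
  by case: m => m; [exists m, 0%N | exists 0%N, m.+1]; lia.
have [k [l ->]] := diff i; have [k' [l' ->]] := diff j.
rewrite !expfzDr // -!invr_expz mulrACA -invfM => /(canRL (divfK _)).
rewrite mul1r mulf_neq0 ?expfz_neq0 // => /(_ isT) /inj_xy [-> ->].
by rewrite !subrr.
Qed.

Lemma fracX_transcendental (L : fieldType) (c : L) :
  tofrac ('X : {poly L}) * tofrac c%:P != 1.
Proof.
rewrite -tofracM -tofrac1 tofrac_eq.
apply/eqP => /(congr1 (fun p : {poly L} => p.[0])); rewrite !hornerE /=.
by move/eqP; rewrite eq_sym oner_eq0.
Qed.

(** * Transfer from the coefficient field to an extension containing a *)

Section ScalarExtension.
Variables (L M : fieldType) (phi : {rmorphism L -> M}) (q t : L) (a : M).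
Hypotheses (q0 : q != 0) (t0 : t != 0) (a0 : a != 0).
Hypothesis qt_generic : forall i j : int, q ^ i * t ^ j = 1 -> i = 0 /\ j = 0.
Hypothesis a_generic : forall c, a * phi c != 1.

Let fq0 : phi q != 0. Proof. by rewrite fmorph_eq0. Qed.

Let ft0 : phi t != 0. Proof. by rewrite fmorph_eq0. Qed.

Let fqt_generic (i j : int) : phi q ^ i * phi t ^ j = 1 -> i = 0 /\ j = 0.
Proof.
rewrite -!fmorphXz -rmorphM /= -(rmorph1 phi) => /fmorph_inj; exact: qt_generic.
Qed.

Let fa_generic (i j : int) : a * (phi q ^ i * phi t ^ j) != 1.
Proof. by rewrite -!fmorphXz -rmorphM. Qed.

Lemma meval_map n (G : {mpoly L[n]}) (v : 'I_n -> L) :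
  (map_mpoly phi G).@[fun i => phi (v i)] = phi G.@[v].
Proof.
rewrite (map_mpolyE _ (leqnn (msize G))) [G in RHS](mpolywE (leqnn (msize G))).
rewrite (raddf_sum (meval v)) (raddf_sum (meval _)) (raddf_sum phi) /=.
apply: eq_bigr => m _.
rewrite !mevalZ rmorphM !mevalX rmorph_prod; congr (_ * _).
by apply: eq_bigr => i _; rewrite rmorphXn.
Qed.

Lemma msize_map n (G : {mpoly L[n]}) : msize (map_mpoly phi G) = msize G.
Proof. by rewrite !msizeE; apply: perm_big; apply/msupp_map_mpoly/fmorph_inj. Qed.

Lemma map_spectral n (v : 'I_n.+1 -> int) c i :
  c * phi (q ^ v i * t ^- kstat v i) = spectral (phi q) (phi t) c v i.
Proof. by rewrite /spectral rmorphM fmorphXz fmorphV rmorphXn. Qed.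

Variables (n : nat).
Local Notation N := n.+1.
Implicit Types (al be : 'X_{1..N}) (G : {mpoly L[N]}).

(** This and the next two definitions unfold, for the concrete q, t, a and embedding, to the notions
    of the theorem, so the final transfer is by conversion. *)
Definition interpolates al G : Prop :=
  [/\ (msize G <= (mdeg al).+1)%N,
      forall be, (mdeg be <= mdeg al)%N -> be != al ->
        G.@[fun i => q ^ zvec be i * t ^- kstat (zvec be) i] = 0
    & G@_al = 1].

Definition dual_value G be : M :=
  (map_mpoly phi G).@[fun i =>
    a * phi (q ^ opp_int (zvec be) i * t ^- kstat (opp_int (zvec be)) i)].

Definition origin_value G : M := (map_mpoly phi G).@[fun i => a * phi (t ^- i)].

Lemma vanishing_map al G : interpolates al G ->
  vanishing (phi q) (phi t) al (fun x => (map_mpoly phi G).@[x]).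
Proof.
move=> [dG G0 _]; split=> [|be le_be be_al].
  by exists (map_mpoly phi G); rewrite ?msize_map.
rewrite -(meval_eq _ (map_spectral (zvec be) 1)) -[RHS](rmorph0 phi) -(G0 be le_be be_al).
by rewrite -meval_map; apply: meval_eq => i; rewrite mul1r.
Qed.

Lemma interpolates_ratio al G : interpolates al G ->
  exists2 f, normalized (phi q) (phi t) a al f &
    forall be, dual_value G be / origin_value G = f (dual_point (phi q) (phi t) a be).
Proof.
move=> GI; have vG := vanishing_map GI; have [dG _ Gal] := GI.
have [f nf] := normalized_exists fq0 ft0 fqt_generic a0 fa_generic al.
have fE := normalized_scale fq0 ft0 fqt_generic nf vG.
exists f => // be; rewrite /dual_value (meval_eq _ (map_spectral _ a)) fE.
have -> : origin_value G = (map_mpoly phi G).@[dual_point (phi q) (phi t) a 0%MM].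
  by apply: meval_eq => i; rewrite dual_point0 fmorphV rmorphXn.
rewrite mulrC mulrA mulVf ?mul1r //.
(* If the value at a tau were 0, G would vanish identically, hence be the zero polynomial by
   unisolvence, against its coefficient 1 at [al]. *)
apply/eqP => G0; have /eqP[] := oner_neq0 M.
rewrite -(rmorph1 phi) -Gal -mcoeff_map_mpoly.
have /= G00 x : (map_mpoly phi G).@[x] = 0 by rewrite fE G0 mul0r.
have dGm := leqnn (msize (map_mpoly phi G)).
by rewrite (mpoly_unisolvence fq0 ft0 fqt_generic dGm) ?mcoeff0.
Qed.

Lemma interpolates_duality al be G H : interpolates al G -> interpolates be H ->
  dual_value G be / origin_value G = dual_value H al / origin_value H.
Proof.
move=> /interpolates_ratio[f nf ->] /interpolates_ratio[g ng ->].
exact: (normalized_duality fq0 ft0 fqt_generic a0 fa_generic nf ng).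
Qed.

End ScalarExtension.

(** * The concrete fields Q(q,t) and Q(q,t,a) *)

HB.instance Definition _ := GRing.RMorphism.copy iota_FK (@tofrac _ \o @polyC F).

Lemma q_neq0 : q != 0.
Proof. by rewrite /q tofrac_eq0 -msize_poly_eq0 msizeX. Qed.

Lemma t_neq0 : t != 0.
Proof. by rewrite /t tofrac_eq0 -msize_poly_eq0 msizeX. Qed.

Lemma a_neq0 : a != 0.
Proof. by rewrite /a tofrac_eq0 polyX_eq0. Qed.

Lemma qt_monomial_inj (i j k l : nat) :
  q ^+ i * t ^+ j = q ^+ k * t ^+ l -> i = k /\ j = l.
Proof.
rewrite /q /t -!tofracXn -!tofracM => /eqP; rewrite tofrac_eq !mpolyXn -!mpolyXD.
move=> /eqP; set m := (X in _ = 'X_[X]) => /(congr1 (mcoeff m)).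
rewrite !mcoeffX eqxx; case: eqP => [/mnmP eq_m _|_ /eqP]; last by rewrite eq_sym oner_eq0.
by split; [have := eq_m 0 | have := eq_m 1]; rewrite !mnmDE !mulmnE !mnm1E /=; lia.
Qed.

Lemma qt_generic (i j : int) : q ^ i * t ^ j = 1 -> i = 0 /\ j = 0.
Proof. exact: monomial_inj_int q_neq0 t_neq0 qt_monomial_inj i j. Qed.

Lemma a_generic (c : F) : a * iota_FK c != 1.
Proof. exact: fracX_transcendental. Qed.

Lemma eval_scaled_tau n (G : {mpoly F[n.+1]}) :
  eval_scaled G (@tau n.+1) = origin_value iota_FK t a G.
Proof. by []. Qed.

Lemma eval_scaled_tilde n (G : {mpoly F[n.+1]}) be :
  eval_scaled G (tilde (zvec be)) = dual_value iota_FK q t a G be.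
Proof. by []. Qed.

Theorem theoremB (n : nat) (hn : (0 < n)%N) (alpha beta : 'X_{1..n})
    (G_alpha G_beta : {mpoly F[n]})
    (hGalpha : is_interpolation_macdonald alpha G_alpha)
    (hGbeta : is_interpolation_macdonald beta G_beta) :
  eval_scaled G_alpha (tilde (zvec beta)) / eval_scaled G_alpha (@tau n)
  = eval_scaled G_beta (tilde (zvec alpha)) / eval_scaled G_beta (@tau n).
Proof.
case: n hn alpha beta G_alpha G_beta hGalpha hGbeta => [hn|n _ al be G H GI HI].
  discriminate hn.
rewrite !eval_scaled_tau !eval_scaled_tilde.
exact (@interpolates_duality F K iota_FK q t a q_neq0 t_neq0 a_neq0 qt_generic
  a_generic n al be G H GI HI).
Qed.
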